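(* The number $x'_G$ is algebraic with minimal polynomial $P_{x_G}=-106929 + 9380331 x^2 - 257190919 x^4 + 2410771629 x^6 - 11872837680 x^8 + 35430882432 x^{10} - 66974055936 x^{12} + 79549160448 x^{14} - 56180293632 x^{16} + 20514865152 x^{18} - 2573205504 x^{20} + 139460608 x^{22}$ (it vanishes at $x'_G$ and is irreducible over $\mathbb Q$).
   Context: Consider real numbers $t,T$ and points $A=(0,0)$, $B=(t,T)$, $C=(2t,0)$ and $P=(x_P,y_P)$ for $P\in\{D,E,F,G,H,J\}$ satisfying the system $t^2+T^2=1$; $-t(x_D-2t)+T y_D=\tfrac32$; $(x_D-2t)^2+y_D^2=9$; $t(x_E-t)-T(y_E-T)+1=0$; $(x_E-t)^2+(y_E-T)^2=4$; $x_F^2+y_F^2=1$; $|E-F|^2=1$; $|F-G|^2=1$; $|D-G|^2=4$; $|D-H|^2=4$; $|G-H|^2=4$; $|F-J|^2=1$; $|G-J|^2=1$; $x_H=x_J$. Fix the real solution with $t\approx0.992685948824186$, $T\approx0.120725337054926$, $D\approx(0.809996600722107,\,2.760161754567202)$, $E\approx(0.209102417540010,\,1.960833173433061)$, $F\approx(-0.061398137844065,\,0.998113354619244)$, $G\approx(-0.838419516770942,\,1.627587561152422)$, $H\approx(-0.995049481192288,\,3.621444891616507)$, $J\approx(-0.995049481192288,\,0.639930204451542)$. These points are the essential vertices of one quarter of the Harborth graph, whose center of symmetry is $K=(x_J,0)$. In the coordinate system centered at $K$ with axes the symmetry axes, the $x$-coordinate of a point $P$ is $x'_P=x_P-x_J$.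 *)

(* Defs.v *)
From mathcomp Require Import all_boot all_order all_algebra.
From mathcomp Require Import reals.

Set Implicit Arguments.
Unset Strict Implicit.
Unset Printing Implicit Defensive.

Import Order.TTheory GRing.Theory Num.Theory.

Local Open Scope ring_scope.

Local Set Warnings "-abstract-large-number".

(* Squared Euclidean distance |P - Q|^2 between points of the plane. *)
Definition sqdist (R : realType) (P Q : R * R) : R :=
  (P.1 - Q.1) ^+ 2 + (P.2 - Q.2) ^+ 2.

(* The remaining vertices are A = (0, 0), B = (t, T) and C = (2t, 0); their
   coordinates are substituted in the equations. *)
Definition harborth_system (R : realType) (t T : R) (D E F G H J : R * R) :
    Prop :=
  t ^+ 2 + T ^+ 2 = 1 /\
  - t * (D.1 - 2 * t) + T * D.2 = 3 / 2 /\
  (D.1 - 2 * t) ^+ 2 + D.2 ^+ 2 = 9 /\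
  t * (E.1 - t) - T * (E.2 - T) + 1 = 0 /\
  (E.1 - t) ^+ 2 + (E.2 - T) ^+ 2 = 4 /\
  F.1 ^+ 2 + F.2 ^+ 2 = 1 /\
  sqdist E F = 1 /\
  sqdist F G = 1 /\
  sqdist D G = 4 /\
  sqdist D H = 4 /\
  sqdist G H = 4 /\
  sqdist F J = 1 /\
  sqdist G J = 1 /\
  H.1 = J.1.

(* [approx15 x a] : x agrees with the decimal a * 10^-15 to within one unit of
   its fifteenth (last) decimal place. *)
Definition approx15 (R : realType) (x a : R) : Prop :=
  `|x - a / 10 ^+ 15| <= 10 ^- 15.

(* The decimal values that select the solution, each scaled by 10^15. *)
Definition harborth_approx (R : realType) (t T : R) (D E F G H J : R * R) :
    Prop :=
  approx15 t 992685948824186%:R /\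
  approx15 T 120725337054926%:R /\
  approx15 D.1 809996600722107%:R /\
  approx15 D.2 2760161754567202%:R /\
  approx15 E.1 209102417540010%:R /\
  approx15 E.2 1960833173433061%:R /\
  approx15 F.1 (- 61398137844065%:R) /\
  approx15 F.2 998113354619244%:R /\
  approx15 G.1 (- 838419516770942%:R) /\
  approx15 G.2 1627587561152422%:R /\
  approx15 H.1 (- 995049481192288%:R) /\
  approx15 H.2 3621444891616507%:R /\
  approx15 J.1 (- 995049481192288%:R) /\
  approx15 J.2 639930204451542%:R.

(* The x-coordinate of P relative to the center of symmetry K = (J.1, 0). *)
Definition centered_x (R : realType) (J P : R * R) : R := P.1 - J.1.

Definition P_xG : {poly rat} :=
  (- 106929%:R)%:P
  + 9380331%:R *: 'X^2
  - 257190919%:R *: 'X^4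
  + 2410771629%:R *: 'X^6
  - 11872837680%:R *: 'X^8
  + 35430882432%:R *: 'X^10
  - 66974055936%:R *: 'X^12
  + 79549160448%:R *: 'X^14
  - 56180293632%:R *: 'X^16
  + 20514865152%:R *: 'X^18
  - 2573205504%:R *: 'X^20
  + 139460608%:R *: 'X^22.

(* "p is the minimal polynomial of x over the rationals", normalized only up
   to a nonzero rational factor: p need not be monic. *)
Definition minimal_polynomial_rat (R : realType) (p : {poly rat}) (x : R) :
    Prop :=
  root (map_poly ratr p) x /\ irreducible_poly p.

(* Main.v *)
Require Import Defs.
From mathcomp Require Import all_boot all_order all_algebra all_field.
From mathcomp Require Import reals ring lra zify.

(* Write [s] for the square root of 3 and [x] for the coordinate in question.
   The triangles FGJ and DGH, as well as the isosceles configurations at B and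
   C, are equilateral up to scaling, so all directions are obtained from
   [G - J = (x, s q)], [G - H = (x, s r)] and [B = (t, T)] by rotations through
   multiples of 60 degrees; in particular [x^2 + 3 q^2 = 1],
   [x^2 + 3 r^2 = 4], and [F - D] is linear in [x, q, r].  Since [D - E] is a
   unit vector, [|E - F| = 1] fixes its scalar product with [F - D], and
   [|F| = 1] then becomes a polynomial relation between [x], [q] and [r].  Its
   norm down to the polynomials in [x] is a constant times [(x^2 - 1) P_xG].

   Irreducibility already holds modulo 17: a proper factor would give a root
   [a] in a field of 17^d elements with d <= 11, hence [a^(17^d) = a], but the
   product of the polynomials [X^(17^d) - X], 1 <= d <= 11, is invertible
   modulo 17 and [P_xG]. *)

Set Implicit Arguments.
Unset Strict Implicit.
Unset Printing Implicit Defensive.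

Import Order.TTheory GRing.Theory Num.Theory.

Local Open Scope ring_scope.

(** * Arithmetic modulo a prime and a monic polynomial *)

Section ModularPolynomials.
(* A list [a] of residues stands for the polynomial with coefficients [a],
   lowest degree first, modulo [p] and ['X^(size rho) - rho]. *)
Variables (p : nat) (rho : seq nat).

Fixpoint addp (a b : seq nat) : seq nat :=
  match a, b with
  | [::], _ => b
  | _, [::] => a
  | x :: a', y :: b' => (x + y) %% p :: addp a' b'
  end%N.

Definition scalep (c : nat) (a : seq nat) : seq nat :=
  [seq (c * x) %% p | x <- a]%N.

(** A coefficient pushed to degree [size rho] is folded back as a multiple of [rho]. Longer lists
    stay unreduced, so evaluation needs no length hypothesis. *)
Definition mulXp (a : seq nat) : seq nat :=
  let b := 0%N :: a in
  if drop (size rho) b is [:: c] then addp (take (size rho) b) (scalep c rho)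
  else b.

Definition mulp (a b : seq nat) : seq nat :=
  foldr (fun c r => addp (scalep c b) (mulXp r)) [::] a.

Definition expp (a : seq nat) (k : nat) : seq nat := iter k (mulp a) [:: 1%N].

Definition frobenius_iter (d : nat) : seq nat :=
  iter d (expp^~ p) [:: 0; 1]%N.

(** The list [[:: 0; p.-1]] encodes -X modulo [p]. *)
Definition frobenius_diffs (n : nat) : seq nat :=
  foldr mulp [:: 1%N]
    [seq addp (frobenius_iter d) [:: 0; p.-1]%N | d <- iota 1 n].

Variables (K : comNzRingType) (alpha : K).
Hypotheses (p_gt0 : (0 < p)%N) (p_eq0 : p%:R = 0 :> K).

Definition evalp (a : seq nat) : K := foldr (fun c r => c%:R + alpha * r) 0 a.

Hypothesis alpha_rho : alpha ^+ size rho = evalp rho.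

Lemma natr_modp (n : nat) : (n %% p)%N%:R = n%:R :> K.
Proof. by rewrite [in RHS](divn_eq n p) natrD natrM p_eq0 mulr0 add0r. Qed.

Lemma evalp_add (a b : seq nat) : evalp (addp a b) = evalp a + evalp b.
Proof.
elim: a b => [|x a IHa] [|y b] /=; rewrite ?add0r ?addr0 //.
by rewrite IHa natr_modp natrD; ring.
Qed.

Lemma evalp_scale (c : nat) (a : seq nat) :
  evalp (scalep c a) = c%:R * evalp a.
Proof.
elim: a => [|x a IHa] /=; first by rewrite mulr0.
by rewrite IHa natr_modp natrM; ring.
Qed.

Lemma evalp_cat (a b : seq nat) :
  evalp (a ++ b) = evalp a + alpha ^+ size a * evalp b.
Proof.
elim: a => [|x a IHa] /=; first by rewrite mul1r add0r.
by rewrite IHa exprS; ring.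
Qed.

Lemma evalp_mulX (a : seq nat) : evalp (mulXp a) = alpha * evalp a.
Proof.
have -> : alpha * evalp a = evalp (0%N :: a) by rewrite /= add0r.
rewrite /mulXp; set b := 0%N :: a; case E: (drop _ b) => [|c [|c' r]] //.
rewrite evalp_add evalp_scale -alpha_rho -[in RHS](cat_take_drop (size rho) b).
rewrite E evalp_cat /= mulr0 addr0 size_takel ?[c%:R * _]mulrC //.
by rewrite ltnW // -subn_gt0 -size_drop E.
Qed.

Lemma evalp_mul (a b : seq nat) : evalp (mulp a b) = evalp a * evalp b.
Proof.
elim: a => [|c a IHa] /=; first by rewrite mul0r.
by rewrite evalp_add evalp_scale evalp_mulX IHa; ring.
Qed.

Lemma evalp_exp (a : seq nat) (k : nat) : evalp (expp a k) = evalp a ^+ k.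
Proof.
elim: k => [|k IHk] /=; first by rewrite mulr0 addr0 expr0.
by rewrite evalp_mul IHk exprS.
Qed.

Lemma evalp_frobenius_iter (d : nat) :
  evalp (frobenius_iter d) = alpha ^+ (p ^ d).
Proof.
elim: d => [|d IHd]; first by rewrite /= expr1; ring.
by rewrite /frobenius_iter iterS evalp_exp IHd -exprM expnSr.
Qed.

(** A fixed [alpha] would annihilate one factor of [frobenius_diffs]; [u] certifies that the product
    is invertible. *)
Lemma frobenius_power_neq (n : nat) (u : seq nat) :
    evalp (mulp u (frobenius_diffs n)) = 1 ->
  forall d, (0 < d <= n)%N -> alpha ^+ (p ^ d) != alpha.
Proof.
move=> u_inv d d_le; apply/eqP=> alpha_fix.
have : evalp (frobenius_diffs n) = 0.
  have : d \in iota 1 n by rewrite mem_iota add1n ltnS.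
  rewrite /frobenius_diffs; elim: (iota 1 n) => //= e s IHs.
  rewrite inE evalp_mul => /orP[/eqP <-|/IHs ->]; last by rewrite mulr0.
  rewrite evalp_add evalp_frobenius_iter alpha_fix /=.
  have -> : alpha + (0%:R + alpha * (p.-1%:R + alpha * 0)) = alpha * p%:R.
    by rewrite -[in RHS](prednK p_gt0) -natr1; ring.
  by rewrite p_eq0 mulr0 mul0r.
by move=> w0; move: u_inv (oner_neq0 K); rewrite evalp_mul w0 mulr0 => <-;
  rewrite eqxx.
Qed.

End ModularPolynomials.

(** * Irreducibility over the rationals from a prime field *)

Lemma exists_irreducible_factor (F : finFieldType) (f : {poly F}) :
  (1 < size f)%N -> exists2 g, irreducible_poly g & g %| f.
Proof.
have [n] := ubnP (size f); elim: n f => // n IHn f f_lt f_gt1.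
have [/irreducibleP f_irr|] := boolP (irreducibleb f); first by exists f.
rewrite /irreducibleb f_gt1 negb_forall => /existsP[/= h].
rewrite negb_imply -Pdiv.Idomain.dvdpE -ltnNge => /andP[h_dvd h_gt1].
have [|//|g g_irr g_dvd] := IHn h.
  by rewrite (leq_ltn_trans (size_npoly h)) // prednK // ltnW.
by exists g => //; apply: dvdp_trans h_dvd.
Qed.

(** The field is F[X] modulo [g] made monic, with the class of X as root. *)
Lemma irreducible_factor_root (F : finFieldType) (g : {poly F}) :
    irreducible_poly g ->
  exists (K : finFieldType) (phi : {rmorphism {poly F} -> K}),
    phi g = 0 /\ #|K| = (#|F| ^ (size g).-1)%N.
Proof.
move=> g_irr; pose m := (lead_coef g)^-1 *: g.
have g_neq0 : g != 0 by rewrite irredp_neq0.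
have lc_neq0 : (lead_coef g)^-1 != 0 by rewrite invr_eq0 lead_coef_eq0.
have m_irr : monic_irreducible_poly m.
  split; last by rewrite monicE lead_coefZ mulVf // lead_coef_eq0.
  have [g_gt1 g_div] := g_irr; split=> [|q q_neq1]; rewrite ?size_scale //.
  rewrite dvdpZr // => /(g_div _ q_neq1)/eqp_trans; apply.
  by rewrite eqp_sym eqp_scale.
exists {poly %/ m with m_irr}, (in_qpoly m); split; last first.
  by rewrite card_qfpoly size_scale.
have -> : g = (lead_coef g)%:P * m.
  by rewrite mul_polyC scalerA mulfV ?scale1r // lead_coef_eq0.
rewrite rmorphM /=; suff -> : in_qpoly m m = 0 by rewrite mulr0.
by apply: val_inj; rewrite /= mk_monicE // Pdiv.RingMonic.rmodpp ?m_irr.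
Qed.

(** A reducible [f] has an irreducible factor of degree d at most half its own; its root in a field
    of #|F|^d elements is fixed by the corresponding power map. *)
Lemma irreducible_by_frobenius (F : finFieldType) (f : {poly F}) :
    (1 < size f)%N ->
    (forall (K : finFieldType) (phi : {rmorphism {poly F} -> K}) (d : nat),
      phi f = 0 -> (0 < d <= (size f).-1./2)%N ->
      phi 'X ^+ (#|F| ^ d) != phi 'X) ->
  irreducible_poly f.
Proof.
move=> f_gt1 f_free; split=> // q q_neq1 q_dvd; apply: contraT => q_neqp.
have f_neq0 : f != 0 by rewrite -size_poly_gt0 ltnW.
have q_neq0 : q != 0 by apply: contraNneq f_neq0 => q0; rewrite -dvd0p -q0.
have [r Ef] := dvdpP _ _ q_dvd.
have r_neq0 : r != 0 by apply: contraNneq f_neq0 => r0; rewrite Ef r0 mul0r.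
have Esize : ((size f).-1 = (size r).-1 + (size q).-1)%N.
  rewrite Ef size_mul //; move: r_neq0 q_neq0; rewrite -!size_poly_gt0.
  by case: (size r) (size q) => [|a] [|b] //= _ _; rewrite addnS.
have r_neq1 : size r != 1%N.
  apply: contraNneq q_neqp => r1; rewrite -dvdp_size_eqp //.
  by move: Esize; rewrite r1 add0n; move: q_neq0; rewrite -size_poly_gt0;
    case: (size q) (size f) f_gt1 => [|a] [|b] //= _ _ ->.
have [h [h_gt1 h_dvd h_le]] :
  exists h : {poly F},
    [/\ (1 < size h)%N, h %| f & ((size h).-1 <= (size f).-1./2)%N].
  have gt1 (s : {poly F}) : s != 0 -> size s != 1%N -> (1 < size s)%N.
    by rewrite -size_poly_gt0; case: (size s) => [|[]].
  case: (leqP (size q) (size r)) => le_qr; [exists q | exists r].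
    split; rewrite ?gt1 // Esize geq_half_double -addnn leq_add2r.
    by rewrite -!subn1 leq_sub2r.
  split; rewrite ?gt1 // ?Ef ?dvdp_mulr // -Ef Esize geq_half_double -addnn.
  by rewrite leq_add2l -!subn1 leq_sub2r // ltnW.
have [g g_irr g_dvd] := exists_irreducible_factor h_gt1.
have [K [phi [phi_g cardK]]] := irreducible_factor_root g_irr.
have phi_f : phi f = 0.
  have /dvdpP[s ->] := dvdp_trans g_dvd h_dvd.
  by rewrite rmorphM phi_g mulr0.
have g_gt1 : (1 < size g)%N by case: g_irr.
have d_bound : (0 < (size g).-1 <= (size f).-1./2)%N.
  rewrite -subn1 subn_gt0 g_gt1 subn1 (leq_trans _ h_le) //.
  by rewrite -!subn1 leq_sub2r // dvdp_leq // -size_poly_gt0 ltnW.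
by have := f_free K phi _ phi_f d_bound; rewrite -cardK expf_card eqxx.
Qed.

(** Gauss's lemma gives an integral factorisation q * r. Neither factor grows modulo [p] and the
    total size is kept, so both keep their sizes; irreducibility of [fp] then forces r to be
    constant. *)
Lemma irreducible_rat_of_mod (p : nat) (f : {poly int}) :
    let fp := map_poly (intr : int -> 'F_p) f in
    size fp = size f -> irreducible_poly fp ->
  irreducible_poly (map_poly (intr : int -> rat) f).
Proof.
move=> fp size_fp fp_irr; apply/irreducible_rat_int.
have f_gt1 : (1 < size f)%N by rewrite -size_fp; case: fp_irr.
have f_neq0 : f != 0 by rewrite -size_poly_gt0 ltnW.
apply/irreducible_rat_int; split; first by rewrite size_rat_int_poly.
move=> q' q'_neq1 /dvdpP_rat_int[q [a a_neq0 Eq'] [r Ef]].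
move: q'_neq1; rewrite Eq' size_scale // size_rat_int_poly => q_neq1.
apply: (eqp_trans (eqp_scale _ a_neq0)).
move: f_neq0; rewrite Ef mulf_eq0 negb_or => /andP[q_neq0 r_neq0].
pose qp := map_poly (intr : int -> 'F_p) q.
pose rp := map_poly (intr : int -> 'F_p) r.
have Efp : fp = qp * rp by rewrite /fp Ef rmorphM.
have fp_neq0 : fp != 0 by rewrite -size_poly_gt0 size_fp ltnW.
have [qp_neq0 rp_neq0] : qp != 0 /\ rp != 0.
  by apply/andP; rewrite -negb_or -mulf_eq0 -Efp.
have le_q : (size qp <= size q)%N by apply: size_poly.
have le_r : (size rp <= size r)%N by apply: size_poly.
have [size_q size_r] : size qp = size q /\ size rp = size r.
  have arith (a' b c d : nat) : (0 < a' -> 0 < b -> a' <= c -> b <= d ->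
      (a' + b).-1 = (c + d).-1 -> a' = c /\ b = d)%N by lia.
  by apply: arith; rewrite ?size_poly_gt0 // -!size_mul // -Efp -Ef.
have [_ /(_ qp)] := fp_irr; rewrite size_q Efp dvdp_mulIl => /(_ q_neq1 isT).
move/eqp_size; rewrite size_mul // size_q size_r.
move: q_neq0 r_neq0; rewrite -!size_poly_gt0 => q_gt0 r_gt0 Eqr.
have /eqP/size_poly1P[c c_neq0 ->] : size r = 1%N.
  have arith (b c : nat) : (0 < b -> 0 < c -> b = (b + c).-1 -> c = 1)%N by lia.
  exact: arith q_gt0 r_gt0 Eqr.
by rewrite mulrC mul_polyC map_polyZ /= eqp_sym eqp_scale // intr_eq0.
Qed.

(** * Even polynomials of degree 22 over varying rings *)

Section EvenPolynomial.
Variables c0 c1 c2 c3 c4 c5 c6 c7 c8 c9 c10 c11 : nat.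

Definition even_poly12 (R : nzRingType) : {poly R} :=
  (- c0%:R)%:P + c1%:R *: 'X^2 - c2%:R *: 'X^4 + c3%:R *: 'X^6
  - c4%:R *: 'X^8 + c5%:R *: 'X^10 - c6%:R *: 'X^12 + c7%:R *: 'X^14
  - c8%:R *: 'X^16 + c9%:R *: 'X^18 - c10%:R *: 'X^20 + c11%:R *: 'X^22.

Definition even_value12 (R : nzRingType) (x : R) : R :=
  - c0%:R + c1%:R * x ^+ 2 - c2%:R * x ^+ 4 + c3%:R * x ^+ 6
  - c4%:R * x ^+ 8 + c5%:R * x ^+ 10 - c6%:R * x ^+ 12 + c7%:R * x ^+ 14
  - c8%:R * x ^+ 16 + c9%:R * x ^+ 18 - c10%:R * x ^+ 20 + c11%:R * x ^+ 22.

Lemma map_even_poly12 (A B : nzRingType) (f : {rmorphism A -> B}) :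
  map_poly f (even_poly12 A) = even_poly12 B.
Proof.
rewrite /even_poly12 !(rmorphD, rmorphN) /=.
rewrite !map_polyZ !map_polyC !map_polyXn /=.
by rewrite !(rmorphN, rmorph_nat).
Qed.

(** Seen as a value at 'X, the polynomial is transported by [rmorph_even_value12] both along
    evaluation and into extension fields. *)
Lemma even_poly12_value (R : nzRingType) :
  even_poly12 R = even_value12 ('X : {poly R}).
Proof.
by rewrite /even_poly12 /even_value12 !scaler_nat !mulr_natl polyCN polyC_natr.
Qed.

Lemma rmorph_even_value12 (A B : nzRingType) (f : {rmorphism A -> B}) (x : A) :
  f (even_value12 x) = even_value12 (f x).
Proof.
have fE (c k : nat) : f (c%:R * x ^+ k) = c%:R * f x ^+ k.
  by rewrite rmorphM rmorphXn rmorph_nat.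
by rewrite /even_value12 !(rmorphD, rmorphN) /= !fE rmorph_nat.
Qed.

Lemma horner_even_poly12 (R : comNzRingType) (x : R) :
  (even_poly12 R).[x] = even_value12 x.
Proof.
rewrite even_poly12_value -[LHS]/(horner_eval x _) rmorph_even_value12 /=.
by rewrite /horner_eval hornerX.
Qed.

Lemma size_even_poly12 (R : idomainType) :
  c11%:R != 0 :> R -> size (even_poly12 R) = 23%N.
Proof.
move=> c11_neq0.
have sizeX k : size (c11%:R *: 'X^k : {poly R}) = k.+1.
  by rewrite size_scale ?size_polyXn.
rewrite /even_poly12 addrC size_polyDl sizeX // ltnS.
have sizeD (f g : {poly R}) :
    (size f <= 22 -> size g <= 22 -> size (f + g)%R <= 22)%N.
  by move=> f_le g_le; rewrite (leq_trans (size_polyD _ _)) // geq_max f_le.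
rewrite !sizeD ?size_polyN ?(leq_trans (size_scale_leq _ _)) ?size_polyXn //.
by rewrite (leq_trans (size_polyC_leq1 _)).
Qed.

Lemma root_even_poly12 (F : numFieldType) (x : F) :
  root (map_poly ratr (even_poly12 rat)) x = (even_value12 x == 0).
Proof. by rewrite map_even_poly12 rootE horner_even_poly12. Qed.

Lemma irreducible_even_poly12 (p : nat) :
    prime p -> c11%:R != 0 :> 'F_p ->
    (forall (K : fieldType) (x : K), p%:R = 0 :> K -> even_value12 x = 0 ->
      forall d, (0 < d <= 11)%N -> x ^+ (p ^ d) != x) ->
  irreducible_poly (even_poly12 rat).
Proof.
move=> p_prime lead_neq0 no_root.
have p0 : p%:R = 0 :> 'F_p by apply: pcharf0 (pchar_Fp p_prime).
rewrite -(map_even_poly12 intr); apply: (@irreducible_rat_of_mod p).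
  rewrite map_even_poly12 !size_even_poly12 //.
  apply: contra_neq lead_neq0 => lead0.
  by rewrite -(rmorph_nat (intr : int -> 'F_p)) lead0 rmorph0.
rewrite map_even_poly12.
apply: irreducible_by_frobenius; rewrite size_even_poly12 // => K phi d.
rewrite even_poly12_value rmorph_even_value12 card_Fp // => Px d_le.
apply: no_root => //.
by rewrite -(rmorph_nat phi) -polyC_natr p0 polyC0 rmorph0.
Qed.

End EvenPolynomial.

(** * Irreducibility of [P_xG] by reduction modulo 17 *)

Local Notation P_xG_value := (even_value12 106929 9380331 257190919 2410771629
  11872837680 35430882432 66974055936 79549160448 56180293632 20514865152
  2573205504 139460608).

Lemma P_xG_mod17 (K : fieldType) (x : K) :
    17%:R = 0 :> K -> P_xG_value x = 0 ->
  forall d, (0 < d <= 11)%N -> x ^+ (17 ^ d) != x.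
Proof.
move=> char17 Px.
pose rho := [:: 11; 0; 16; 0; 9; 0; 1; 0; 14; 0; 1; 0; 1; 0; 4; 0; 16; 0; 2; 0;
  15; 0]%N.
pose u := [:: 0; 7; 0; 4; 0; 5; 0; 14; 0; 13; 0; 8; 0; 11; 0; 1; 0; 11; 0; 5;
  0; 12]%N.
(* [6 P_xG = 'X^22 - rho] modulo 17, and [u] is the inverse of
   [frobenius_diffs 17 rho 11]. *)
apply: (@frobenius_power_neq 17 rho K x isT char17 _ 11 u).
  (* The factor 6 inverts the leading coefficient, which is 3 modulo 17; the last term collects the
     remaining multiples of 17. *)
  have : 6 * P_xG_value x = x ^+ 22 - evalp x rho
      + 17%:R * even_value12 37739 3310706 90773265 850860575 4190413298
          12505017329 23637902095 28076174276 19828338928 7240540642 908190177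
          49221391 x.
    by rewrite [evalp _ _]/= /even_value12; ring.
  rewrite Px char17 mulr0 mul0r addr0 => /esym/eqP.
  by rewrite subr_eq0 => /eqP.
have -> : mulp 17 rho u (frobenius_diffs 17 rho 11) = 1%N :: nseq 21 0%N.
  by vm_compute.
by rewrite /=; ring.
Qed.

Lemma F17_char : 17%:R = 0 :> 'F_17.
Proof. exact: val_inj. Qed.

Lemma lead_P_xG_F17 : 139460608%:R != 0 :> 'F_17.
Proof.
have -> : 139460608%:R = 17%:R * 8203565%:R + 3%:R :> 'F_17 by ring.
by rewrite F17_char mul0r add0r.
Qed.

Lemma P_xG_irreducible : irreducible_poly P_xG.
Proof.
apply: (irreducible_even_poly12 (isT : prime 17) lead_P_xG_F17) => K x.
exact: P_xG_mod17.
Qed.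

Lemma root_P_xG (R : realType) (x : R) :
  root (map_poly ratr P_xG) x = (P_xG_value x == 0).
Proof. exact: root_even_poly12. Qed.

(** * Elimination *)

(** The vectors u and v have equal length and meet at 60 degrees. Lagrange's identity gives the
    square of their cross product, the sign hypothesis selects the root, and u is recovered from its
    scalar and cross products with v. *)
Lemma triangle_clockwise_side (R : realFieldType) (s u1 u2 v1 v2 : R) :
    0 < s -> s ^+ 2 = 3 ->
    u1 ^+ 2 + u2 ^+ 2 = v1 ^+ 2 + v2 ^+ 2 ->
    2 * (u1 * v1 + u2 * v2) = v1 ^+ 2 + v2 ^+ 2 ->
    0 < u1 * v2 - u2 * v1 ->
  u1 = v1 / 2 + s / 2 * v2 /\ u2 = v2 / 2 - s / 2 * v1.
Proof.
move=> s0 s2 Euv Edot cross0.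
have Esq : (u1 * v2 - u2 * v1) ^+ 2 = (s / 2 * (u1 ^+ 2 + u2 ^+ 2)) ^+ 2.
  have -> : (u1 * v2 - u2 * v1) ^+ 2 =
    (u1 ^+ 2 + u2 ^+ 2) * (v1 ^+ 2 + v2 ^+ 2) - (u1 * v1 + u2 * v2) ^+ 2.
    by ring.
  have -> : u1 * v1 + u2 * v2 = (v1 ^+ 2 + v2 ^+ 2) / 2 by lra.
  by rewrite -Euv; field: s2.
have Ecross : u1 * v2 - u2 * v1 = s / 2 * (u1 ^+ 2 + u2 ^+ 2).
  have rhs_ge0 : 0 <= s / 2 * (u1 ^+ 2 + u2 ^+ 2).
    by rewrite mulr_ge0 ?divr_ge0 ?addr_ge0 ?sqr_ge0 ?ltW.
  by move/eqP: Esq; rewrite eqf_sqr => /orP[/eqP //|/eqP E]; lra.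
have v_neq0 : v1 ^+ 2 + v2 ^+ 2 != 0.
  by apply/eqP=> v_eq0; move: cross0; rewrite Ecross Euv v_eq0 mulr0 ltxx.
have dot : u1 * v1 + u2 * v2 = (v1 ^+ 2 + v2 ^+ 2) / 2 by lra.
rewrite Euv in Ecross; split; apply: (mulfI v_neq0).
  have -> : (v1 ^+ 2 + v2 ^+ 2) * u1 =
    v1 * (u1 * v1 + u2 * v2) + v2 * (u1 * v2 - u2 * v1) by ring.
  by rewrite dot Ecross; field.
have -> : (v1 ^+ 2 + v2 ^+ 2) * u2 =
  v2 * (u1 * v1 + u2 * v2) - v1 * (u1 * v2 - u2 * v1) by ring.
by rewrite dot Ecross; field.
Qed.

(* For [F - D = (l1, sqrt 3 * l2)], the relation between l1 and l2 that remains
   after the unit vector [D - E] has been eliminated from [|E - F| = 1] and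
   [|F| = 1]. *)
Definition closing_poly (R : realFieldType) (l1 l2 : R) : R :=
  let n := l1 ^+ 2 + 3 * l2 ^+ 2 in
  (n ^+ 2 + 2 * n - 12 * n * l2 ^+ 2 + 30 * l2 ^+ 2 - 6 * l1 * l2) ^+ 2
  - 3 * n * (4 - n) * ((l1 - l2) * (l1 - 3 * l2)) ^+ 2.

(** With c = D - E and l = F - D, the scalar product of c and l is -n/2, and [v], their cross
    product up to sqrt 3, has square n(4 - n)/12. Expressing c through l and [v] makes |F| = 1
    linear in [v]; squaring removes [v]. *)
Lemma closing_condition (R : realFieldType) (l1 l2 c1 c2 : R) :
    let n := l1 ^+ 2 + 3 * l2 ^+ 2 in
    c1 ^+ 2 + 3 * c2 ^+ 2 = 1 ->
    n + 2 * (l1 * c1 + 3 * l2 * c2) = 0 ->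
    ((5 * c1 - 3 * c2) / 2 + l1) ^+ 2 + 3 * (3 * (c1 + c2) / 2 + l2) ^+ 2 = 1 ->
  closing_poly l1 l2 = 0.
Proof.
move=> n Ec Edot EF; rewrite /closing_poly -/n; apply/eqP; rewrite subr_eq0.
apply/eqP.
have [n0|n0] := eqVneq n 0.
  have l2_0 : l2 ^+ 2 = 0.
    by move: n0 (sqr_ge0 l1) (sqr_ge0 l2); rewrite /n; lra.
  by move/eqP: l2_0; rewrite sqrf_eq0 => /eqP ->; rewrite n0; ring.
pose v := l1 * c2 - l2 * c1.
have Edot' : l1 * c1 + 3 * l2 * c2 = - n / 2 by lra.
have Ev : v ^+ 2 = n * (4 - n) / 12.
  have : 3 * v ^+ 2 =
    n * (c1 ^+ 2 + 3 * c2 ^+ 2) - (l1 * c1 + 3 * l2 * c2) ^+ 2.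
    by rewrite /v /n; ring.
  by rewrite Ec Edot'; lra.
have Ec1 : n * c1 = - n / 2 * l1 - 3 * v * l2 by rewrite -Edot' /v /n; ring.
have Ec2 : n * c2 = - n / 2 * l2 + v * l1 by rewrite -Edot' /v /n; ring.
have EAB : n ^+ 2 + 2 * n - 12 * n * l2 ^+ 2 + 30 * l2 ^+ 2 - 6 * l1 * l2 =
    6 * (l1 - l2) * (l1 - 3 * l2) * v.
  have : ((5 * (n * c1) - 3 * (n * c2)) / 2 + n * l1) ^+ 2
       + 3 * (3 * (n * c1 + n * c2) / 2 + n * l2) ^+ 2 = n ^+ 2.
    by rewrite -[RHS]mulr1 -[X in _ = _ * X]EF; field.
  rewrite Ec1 Ec2.
  have El1 : l1 ^+ 2 = n - 3 * l2 ^+ 2 by rewrite /n; ring.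
  pose w := v ^+ 2; have Ew : v ^+ 2 = w by [].
  have En : n ^+ 2 = 4 * n - 12 * w by rewrite /w Ev; field.
  clearbody n v w.
  move/eqP; rewrite -subr_eq0 => /eqP E.
  apply/(mulfI n0)/subr0_eq; rewrite -[RHS]E.
  by field: Ew En El1.
have -> : 3 * n * (4 - n) = 36 * v ^+ 2 by rewrite Ev; field.
by rewrite EAB; ring.
Qed.

Lemma eliminate_qr (R : realFieldType) (x q r : R) :
    q ^+ 2 = (1 - x ^+ 2) / 3 -> r ^+ 2 = (4 - x ^+ 2) / 3 ->
    closing_poly (3 * (q + r) / 2) ((r - q) / 2 - x) = 0 ->
  (x ^+ 2 - 1) * P_xG_value x = 0.
Proof.
move=> Eq Er Phi.
(* [a, b, c, d] are the coordinates of the closing polynomial in the basis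
   1, q, r, qr over the polynomials in x; [e + f q] is the product with its
   conjugate under r -> -r. *)
pose a := 1980%:R - 3318%:R * x ^+ 2 + 6732%:R * x ^+ 4 - 576 * x ^+ 6
  - 768 * x ^+ 8.
pose b := x * (4788%:R - 756 * x ^+ 2 + 8640%:R * x ^+ 4 - 2304%:R * x ^+ 6).
pose c := x *
  (2610%:R - 3780%:R * x ^+ 2 - 5184%:R * x ^+ 4 + 2304%:R * x ^+ 6).
pose d := 2916%:R - 2196%:R * x ^+ 2 - 7488%:R * x ^+ 4 - 2304%:R * x ^+ 6.
have Ex : x ^+ 2 = 1 - 3 * q ^+ 2 by rewrite Eq; field.
have Er' : r ^+ 2 = q ^+ 2 + 1 by rewrite Er Eq; field.
have Phi' : (a + b * q) + (c + d * q) * r = 0.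
  by rewrite -[RHS]Phi /closing_poly /a /b /c /d; field: Ex Er'.
pose e := 141264%:R - 4164480%:R * x ^+ 2 + 65398320%:R * x ^+ 4
  - 35123328%:R * x ^+ 6 - 80220672%:R * x ^+ 8 + 58834944%:R * x ^+ 10
  - 4866048%:R * x ^+ 12.
pose f := x * (- 1334880%:R + 14984352%:R * x ^+ 2 + 162819072%:R * x ^+ 4
  - 207442944%:R * x ^+ 6 + 38817792%:R * x ^+ 8 + 2654208%:R * x ^+ 10).
have Ef : e + f * q = 0.
  have -> : e + f * q =
    ((a + b * q) + (c + d * q) * r) * ((a + b * q) - (c + d * q) * r).
    by rewrite /e /f /a /b /c /d; ring: Ex Er'.
  by rewrite Phi' mul0r.
(* Multiplying by the conjugate under q -> -q completes the norm. *)
have E : 3 * e ^+ 2 - f ^+ 2 * (1 - x ^+ 2) = 0.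
  have -> : 1 - x ^+ 2 = 3 * q ^+ 2 by rewrite Eq; field.
  have -> : 3 * e ^+ 2 - f ^+ 2 * (3 * q ^+ 2) = 3 * (e + f * q) * (e - f * q).
    by ring.
  by rewrite Ef mulr0 mul0r.
(* This is the constant by which the norm exceeds (x^2 - 1) [P_xG]. *)
apply: (@mulfI _ (3 * 432 ^+ 2)).
  by rewrite mulf_neq0 ?expf_neq0 ?pnatr_eq0.
apply: etrans (esym (mulr0 _)); apply: etrans E.
by rewrite /e /f /even_value12; ring.
Qed.

(** * Geometry of the configuration *)

Lemma approx15_between (R : realType) (x a lo hi : R) :
    approx15 x a ->
    lo * 1000000000000000%:R <= a - 1 -> a + 1 <= hi * 1000000000000000%:R ->
  lo <= x <= hi.
Proof.
have E : (10 : R) ^+ 15 = 1000000000000000%:R by ring.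
rewrite /approx15 E ler_norml => /andP[x_ge x_le] lo_le hi_ge.
by apply/andP; split; lra.
Qed.

(** Two decimals suffice: they fix the orientations of the four 60-degree configurations and give 0
    < x < 1. *)
Lemma harborth_coordinate_bounds (R : realType) (t T : R)
    (D E F G H J : R * R) :
    harborth_approx t T D E F G H J ->
  [/\ 99 / 100 <= t <= 1, 12 / 100 <= T <= 13 / 100,
      80 / 100 <= D.1 <= 82 / 100, 276 / 100 <= D.2 <= 277 / 100 &
      20 / 100 <= E.1 <= 21 / 100 /\ 196 / 100 <= E.2 <= 197 / 100] /\
  [/\ - 7 / 100 <= F.1 <= - 6 / 100, 99 / 100 <= F.2 <= 1,
      - 84 / 100 <= G.1 <= - 83 / 100 & 162 / 100 <= G.2 <= 163 / 100] /\
  [/\ - 1 <= H.1 <= - 99 / 100, 362 / 100 <= H.2 <= 363 / 100,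
      - 1 <= J.1 <= - 99 / 100 & 63 / 100 <= J.2 <= 64 / 100].
Proof.
do 13 ![case=> ?]; move=> ?; do !split.
all: match goal with H : approx15 ?x _ |- is_true (_ <= ?x <= _) =>
  by apply: (approx15_between H); clear; lra end.
Qed.

Lemma harborth_closing (R : realType) (t T : R) (D E F G H J : R * R) :
    harborth_system t T D E F G H J -> harborth_approx t T D E F G H J ->
  let x := centered_x J G in
  exists q r, [/\ 0 < x < 1, q ^+ 2 = (1 - x ^+ 2) / 3,
    r ^+ 2 = (4 - x ^+ 2) / 3 &
    closing_poly (3 * (q + r) / 2) ((r - q) / 2 - x) = 0].
Proof.
move=> Hsys /harborth_coordinate_bounds.
move: D E F G H J Hsys => [D1 D2] [E1 E2] [F1 F2] [G1 G2] [H1 H2] [J1 J2].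
rewrite /harborth_system /sqdist /centered_x /=.
move=> [Ht [HD [HD9 [HE [HE4 [HF [HEF [HFG [HDG [HDH [HGH [HFJ [HGJ
  HJ]]]]]]]]]]]]].
move=> [[bt bT bD1 bD2 [bE1 bE2]] [[bF1 bF2 bG1 bG2] [bH1 bH2 bJ1 bJ2]]].
pose s : R := Num.sqrt 3.
have s0 : 0 < s by rewrite sqrtr_gt0.
have s2 : s ^+ 2 = 3 by rewrite sqr_sqrtr.
(* (D - C)/3 and B - C = (-t, T) are unit vectors at 60 degrees. As in the next three steps,
   bounding both terms of the cross product leaves its sign to [lra]. *)
have [eD1 eD2] : (D1 - 2 * t) / 3 = - t / 2 + s / 2 * T /\
    D2 / 3 = T / 2 - s / 2 * - t.
  have m1 : 2 * (99 / 100) <= D2 * t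
    by clear -bD2 bt; apply: ler_pM; lra.
  have m2 : (2 * t - D1) * T <= 2 * (13 / 100)
    by clear -bt bD1 bT; apply: ler_pM; lra.
  by clear -s0 s2 m1 m2 HD HD9 Ht; apply: triangle_clockwise_side => //; lra.
(* E - B makes 120 degrees with C - B, hence 60 with B - C. *)
have [eE1 eE2] : (E1 - t) / 2 = - t / 2 + s / 2 * T /\
    (E2 - T) / 2 = T / 2 - s / 2 * - t.
  have m1 : 1 * (99 / 100) <= (E2 - T) * t
    by clear -bE2 bT bt; apply: ler_pM; lra.
  have m2 : (t - E1) * T <= 1 * (13 / 100)
    by clear -bt bE1 bT; apply: ler_pM; lra.
  by clear -s0 s2 m1 m2 HE HE4 Ht; apply: triangle_clockwise_side => //; lra.
have [eH1 eH2] : D1 - G1 = (H1 - G1) / 2 + s / 2 * (H2 - G2) /\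
    D2 - G2 = (H2 - G2) / 2 - s / 2 * (H1 - G1).
  have m1 : 1 * 1 <= (D1 - G1) * (H2 - G2)
    by clear -bD1 bG1 bH2 bG2; apply: ler_pM; lra.
  have m2 : 0 <= (D2 - G2) * (G1 - H1)
    by clear -bD2 bG2 bG1 bH1; apply: mulr_ge0; lra.
  by clear -s0 s2 m1 m2 HDG HDH HGH; apply: triangle_clockwise_side => //; lra.
have [eF1 eF2] : F1 - J1 = (G1 - J1) / 2 + s / 2 * (G2 - J2) /\
    F2 - J2 = (G2 - J2) / 2 - s / 2 * (G1 - J1).
  have m1 : 9 / 10 * (9 / 10) <= (F1 - J1) * (G2 - J2)
    by clear -bF1 bJ1 bG2 bJ2; apply: ler_pM; lra.
  have m2 : (F2 - J2) * (G1 - J1) <= 1 * (2 / 10)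
    by clear -bF2 bJ2 bG1 bJ1; apply: ler_pM; lra.
  by clear -s0 s2 m1 m2 HGJ HFJ HFG; apply: triangle_clockwise_side => //; lra.
(* Dividing vertical coordinates by sqrt 3 gives rotations by 60 degrees rational coefficients. *)
set x := G1 - J1; pose q := (G2 - J2) / s; pose r := (G2 - H2) / s.
have sN0 : s != 0 by rewrite gt_eqF.
have EH1 : H1 = G1 - x by rewrite HJ /x; ring.
have EJ1 : J1 = G1 - x by rewrite /x; ring.
have EH2 : H2 = G2 - s * r by rewrite /r; field.
have EJ2 : J2 = G2 - s * q by rewrite /q; field.
have Eq : q ^+ 2 = (1 - x ^+ 2) / 3.
  have : x ^+ 2 + s ^+ 2 * q ^+ 2 = 1 by rewrite -[RHS]HGJ EJ2 /x; ring.
  by rewrite s2; clear; lra.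
have Er : r ^+ 2 = (4 - x ^+ 2) / 3.
  have : x ^+ 2 + s ^+ 2 * r ^+ 2 = 4 by rewrite -[RHS]HGH EH2 EH1; ring.
  by rewrite s2; clear; lra.
have EF1 : F1 = G1 - x / 2 + 3 * q / 2.
  by apply: (subIr J1); rewrite eF1 EJ1 EJ2; field: s2.
have EF2 : F2 = G2 - s * (x + q) / 2.
  by apply: (subIr J2); rewrite eF2 EJ1 EJ2; field.
have ED1 : D1 = G1 - x / 2 - 3 * r / 2.
  by apply: (subIr G1); rewrite eH1 EH1 EH2; field: s2.
have ED2 : D2 = G2 + s * (x - r) / 2.
  by apply: (subIr G2); rewrite eH2 EH1 EH2; field.
have x_lt1 : 0 < x < 1 by clear -bG1 bJ1; rewrite /x; lra.
pose l1 := 3 * (q + r) / 2; pose l2 := (r - q) / 2 - x.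
have EFD1 : F1 = D1 + l1 by rewrite EF1 ED1 /l1; field.
have EFD2 : F2 = D2 + s * l2 by rewrite EF2 ED2 /l2; field.
have EE1 : E1 = s * T by clear -eE1; lra.
have EE2 : E2 = 2 * T + s * t by clear -eE2; lra.
have EDt1 : D1 = (t + 3 * s * T) / 2 by clear -eD1; lra.
have EDt2 : D2 = 3 * (T + s * t) / 2 by clear -eD2; lra.
(* D - E = (c1, s * c2). *)
pose c1 := (t + s * T) / 2; pose c2 := (s * t - T) / (2 * s).
have Esc2 : s * c2 = (s * t - T) / 2 by rewrite /c2; field.
have Ec : c1 ^+ 2 + 3 * c2 ^+ 2 = 1.
  by rewrite -s2 -exprMn Esc2 -[RHS]Ht /c1; field: s2.
have Edot : l1 ^+ 2 + 3 * l2 ^+ 2 + 2 * (l1 * c1 + 3 * l2 * c2) = 0.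
  have : (c1 + l1) ^+ 2 + (s * c2 + s * l2) ^+ 2 = 1.
    by rewrite -[RHS]HEF EFD1 EFD2 EE1 EE2 EDt1 EDt2 Esc2 /c1; field.
  by rewrite -mulrDr exprMn s2; clear -Ec; lra.
(* This is |F| = 1, with D = ((5 c1 - 3 c2)/2, 3 s (c1 + c2)/2). *)
have HF' : ((5 * c1 - 3 * c2) / 2 + l1) ^+ 2 +
    3 * (3 * (c1 + c2) / 2 + l2) ^+ 2 = 1.
  have F1c : F1 = (5 * c1 - 3 * c2) / 2 + l1.
    have -> : 3 * c2 = s * ((s * t - T) / 2) by rewrite -Esc2 -s2; ring.
    by rewrite EFD1 EDt1 /c1; field: s2.
  have F2c : F2 = s * (3 * (c1 + c2) / 2 + l2).
    have -> : s * (3 * (c1 + c2) / 2 + l2) =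
      3 * (s * c1 + s * c2) / 2 + s * l2 by field.
    by rewrite EFD2 EDt2 Esc2 /c1; field: s2.
  by rewrite -[X in _ + X * _]s2 -exprMn -F2c -F1c.
by exists q, r; split=> //; apply: closing_condition Ec Edot HF'.
Qed.

Theorem mainTheorem10 (R : realType) (t T : R) (D E F G H J : R * R)
    (Hsys : harborth_system t T D E F G H J)
    (Happrox : harborth_approx t T D E F G H J) :
  algebraicOver (ratr : rat -> R) (centered_x J G) /\
  minimal_polynomial_rat P_xG (centered_x J G).
Proof.
have [q [r [x_lt1 Eq Er closing]]] := harborth_closing Hsys Happrox.
(* This discards the extraneous factor of the norm. *)
have x2N1 : centered_x J G ^+ 2 - 1 != 0 by apply/eqP; clear -x_lt1; nra.
have P_root : root (map_poly ratr P_xG) (centered_x J G).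
  rewrite root_P_xG; apply/eqP/(mulfI x2N1).
  by apply: etrans (esym (mulr0 _)); apply: eliminate_qr closing.
split; last by split; [exact: P_root | exact: P_xG_irreducible].
by exists P_xG; [apply: irredp_neq0 P_xG_irreducible | exact: P_root].
Qed.
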